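(* Let $G \in \mathbb{R}^{N \times N}$ be a real symmetric matrix (weighted undirected graph on vertex set $\{1,\dots,N\}$) with a cospectral pair $\{u,v\}$. Let $p \in \{+1,-1\}$ and let $\mathbb{X}^p_\gamma$ and $\mathbb{Y}^p_\delta$ be (in general non-uniform) walk multiplets of $G$ relative to $\{u,v\}$, both with parity $p$, with real weight tuples $\gamma = (\gamma_x)_{x\in\mathbb{X}}$ and $\delta = (\delta_y)_{y \in \mathbb{Y}}$, and let $\mathbb{Z} = \mathbb{X} \cap \mathbb{Y}$ (possibly nonempty). Define $H \in \mathbb{R}^{N \times N}$ by $$H_{x,y} = H_{y,x} = \begin{cases} G_{x,y} + \gamma_x \delta_y & \text{if } x \notin \mathbb{Z} \text{ or } y \notin \mathbb{Z},\\ G_{x,y} + \gamma_x\delta_y + \gamma_y \delta_x & \text{if } x,y \in \mathbb{Z},\end{cases}\qquad \forall\, x \in \mathbb{X},\ y \in \mathbb{Y},$$ and $H_{i,j} = G_{i,j}$ for all other pairs $(i,j)$. Then $u,v$ are cospectral in $H$, and every walk multiplet of $G$ relative to $\{u,v\}$ with parity $p$ (with its weight tuple) is also a walk multiplet of $H$ relative to $\{u,v\}$ with parity $p$.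
   Context: A real symmetric matrix $H \in \mathbb{R}^{n\times n}$ is identified with an undirected weighted graph on vertices $1,\dots,n$, with edge weight $H_{i,j}$ (diagonal entries are loops). Two vertices $u,v$ are cospectral in $H$ if $[H^k]_{u,u} = [H^k]_{v,v}$ for all integers $k \geq 0$. Given a vertex subset $\mathbb{M}$, a tuple $\gamma = (\gamma_m)_{m\in\mathbb{M}}$ of real numbers, and $p \in \{+1,-1\}$, $\mathbb{M}$ is a walk multiplet $\mathbb{M}_\gamma^p$ of $H$ relative to $u,v$ with parity $p$ if $\sum_{m\in\mathbb{M}}\gamma_m [H^k]_{u,m} = p\sum_{m\in\mathbb{M}}\gamma_m[H^k]_{v,m}$ for all $k\in\{0,\dots,n-1\}$ (equivalently for all integers $k\ge 0$). It is called uniform if all $\gamma_m$ are equal and non-uniform otherwise. *)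

(* Defs.v *)
From HB Require Import structures.
From mathcomp Require Import all_boot all_order all_algebra.
From mathcomp Require Import reals.

Set Implicit Arguments.
Unset Strict Implicit.
Unset Printing Implicit Defensive.

Import Order.TTheory GRing.Theory Num.Theory.
Local Open Scope ring_scope.

Definition cospectral (R : realType) (n : nat) (A : 'M[R]_n) (u v : 'I_n) :
  Prop := forall k : nat, (A ^+ k) u u = (A ^+ k) v v.

(* A weight tuple indexed by a vertex subset M is encoded as a total function
   on the vertices, of which only the values on M are ever used. *)
Definition walk_multiplet (R : realType) (n : nat) (A : 'M[R]_n) (u v : 'I_n)
    (p : R) (M : {set 'I_n}) (gamma : 'I_n -> R) : Prop :=
  forall k : nat, (k < n)%N ->
    \sum_(m in M) gamma m * (A ^+ k) u m
    = p * \sum_(m in M) gamma m * (A ^+ k) v m.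

Section Interconnection.
Variables (R : realType) (n : nat) (G : 'M[R]_n).
Variables (X Y : {set 'I_n}) (gamma delta : 'I_n -> R).

(* The common value of H_{x,y} and H_{y,x}, meaningful for x in X, y in Y. *)
Definition interconnection_weight (x y : 'I_n) : R :=
  let Z := X :&: Y in
  if (x \notin Z) || (y \notin Z) then G x y + gamma x * delta y
  else G x y + gamma x * delta y + gamma y * delta x.

Definition interconnection : 'M[R]_n :=
  \matrix_(i, j)
    if (i \in X) && (j \in Y) then interconnection_weight i j
    else if (j \in X) && (i \in Y) then interconnection_weight j i
    else G i j.

(* The case distinction in [interconnection] is consistent: both (i, j) and
   (j, i) can lie in X * Y only if i and j are both in X :&: Y, where the weight
   is symmetric. *)
Lemma interconnectionE (x y : 'I_n) : G^T = G -> x \in X -> y \in Y ->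
  interconnection x y = interconnection_weight x y
  /\ interconnection y x = interconnection_weight x y.
Proof.
move=> symG xX yY; rewrite !mxE xX yY /=; split=> //.
case: ifP => // /andP[yX xY].
rewrite /interconnection_weight !inE xX xY yX yY /=.
by rewrite -{1}symG mxE -!addrA [gamma y * _ + _]addrC.
Qed.

Lemma interconnection_other (i j : 'I_n) :
  ~~ ((i \in X) && (j \in Y)) -> ~~ ((j \in X) && (i \in Y)) ->
  interconnection i j = G i j.
Proof. by rewrite mxE => /negbTE-> /negbTE->. Qed.

End Interconnection.

(* Main.v *)
Require Import Defs.
From HB Require Import structures.
From mathcomp Require Import all_boot all_order all_algebra.
From mathcomp Require Import reals.
From mathcomp Require Import ring.

Set Implicit Arguments.
Unset Strict Implicit.
Unset Printing Implicit Defensive.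

Import Order.TTheory GRing.Theory Num.Theory.
Local Open Scope ring_scope.

(** Let [c] and [d] be the weight vectors of the two multiplets, extended by
    zero, so that [H = G + c d^T + d c^T].  Put [a = e_u - p e_v].  The vectors
    [w] with [a G^k w = 0] for all [k] form the largest [G]-invariant subspace
    inside the kernel of [a]; by Cayley-Hamilton a weighted set is a walk
    multiplet of parity [p] iff its weight vector lies in this subspace.  It
    contains [c] and [d], hence it is also invariant under [H], so every [w] in
    it satisfies [a H^k w = 0].  Cospectrality of [u] and [v] is the same
    statement for [w = e_u + p e_v], because [p ^ 2 = 1] and the matrices are
    symmetric. *)

Definition krylov_orthogonal (R : comNzRingType) (n : nat) (A : 'M[R]_n)
    (a : 'rV[R]_n) (w : 'cV[R]_n) : Prop :=
  forall k : nat, a *m A ^+ k *m w = 0.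

Section KrylovOrthogonal.
Variables (R : comNzRingType) (n : nat) (A : 'M[R]_n) (a : 'rV[R]_n).

Lemma krylov_orthogonalD (w1 w2 : 'cV[R]_n) :
  krylov_orthogonal A a w1 -> krylov_orthogonal A a w2 ->
  krylov_orthogonal A a (w1 + w2).
Proof. by move=> w1P w2P k; rewrite mulmxDr w1P w2P addr0. Qed.

(** The scalar is a 1 x 1 matrix because it arises as [d^T *m z] in the product
    [c *m (d^T *m z)]. *)
Lemma krylov_orthogonalM (w : 'cV[R]_n) (B : 'M[R]_1) :
  krylov_orthogonal A a w -> krylov_orthogonal A a (w *m B).
Proof. by move=> wP k; rewrite mulmxA wP mul0mx. Qed.

Lemma krylov_orthogonal_stable (w : 'cV[R]_n) :
  krylov_orthogonal A a w -> krylov_orthogonal A a (A *m w).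
Proof. by move=> wP k; rewrite mulmxA -(mulmxA a) -[_ *m A]exprSr. Qed.

Lemma krylov_orthogonal_rank2_update (c d w : 'cV[R]_n) :
  krylov_orthogonal A a c -> krylov_orthogonal A a d ->
  krylov_orthogonal A a w ->
  krylov_orthogonal (A + c *m d^T + d *m c^T) a w.
Proof.
move=> cP dP wP k; set B := _ + _.
(* Strengthened for the induction: [B ^+ k *m w] never leaves the subspace attached to [A]. The
   zeroth power of [A] then gives the claim. *)
suff /(_ 0%N) : krylov_orthogonal A a (B ^+ k *m w).
  by rewrite expr0 mulmx1 mulmxA.
elim: k => [|k]; first by rewrite expr0 mul1mx.
rewrite exprS -[B * _]/(B *m _) -mulmxA; move: (_ *m w) => z zP.
rewrite /B !mulmxDl -!mulmxA.
by do 2?apply: krylov_orthogonalD;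
  [exact: krylov_orthogonal_stable | exact: krylov_orthogonalM ..].
Qed.

End KrylovOrthogonal.

Lemma krylov_orthogonal_ltn (F : fieldType) (n : nat) (A : 'M[F]_n)
    (a : 'rV[F]_n) (w : 'cV[F]_n) :
  (forall k, (k < n)%N -> a *m A ^+ k *m w = 0) -> krylov_orthogonal A a w.
Proof.
(* [horner_mx] needs positive size; in size zero the row [a] is empty. *)
case: n A a w => [|n] A a w wP k; first by rewrite [a]thinmx0 !mul0mx.
have -> : A ^+ k = horner_mx A ('X^k %% char_poly A).
  transitivity (horner_mx A 'X^k); first by rewrite rmorphXn /= horner_mx_X.
  rewrite {1}(divp_eq 'X^k (char_poly A)).
  by rewrite rmorphD rmorphM /= Cayley_Hamilton mulr0 add0r.
(* The characteristic polynomial has size [n.+2], so only powers below [n.+1] occur in [r], exactly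
   the range of [wP]. *)
set r := _ %% _; have ltr : (size r <= n.+1)%N.
  by rewrite -ltnS -(size_char_poly A) ltn_modp monic_neq0 ?char_poly_monic.
rewrite -[r]coefK poly_def rmorph_sum /= mulmx_sumr mulmx_suml big1 // => i _.
rewrite linearZ /= rmorphXn /= horner_mx_X -scalemxAr -scalemxAl wP ?scaler0 //.
exact: leq_trans ltr.
Qed.

Section Multiplets.
Variables (R : realType) (n : nat).
Implicit Types (A : 'M[R]_n) (M : {set 'I_n}) (u v : 'I_n) (p : R).

Definition weight_vector M (mu : 'I_n -> R) : 'cV[R]_n :=
  \col_i (if i \in M then mu i else 0).

Definition parity_row u v p : 'rV[R]_n := delta_mx 0 u - p *: delta_mx 0 v.

Lemma parity_row_mulE A u v p (w : 'cV[R]_n) (i j : 'I_1) :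
  (parity_row u v p *m A *m w) i j =
    \sum_m w m 0 * A u m - p * \sum_m w m 0 * A v m.
Proof.
rewrite /parity_row !mulmxBl -!scalemxAl -!rowE !ord1 !mxE.
by congr (_ - _ * _); apply: eq_bigr => m _; rewrite !mxE mulrC.
Qed.

Lemma weight_vector_sumE M mu (f : 'I_n -> R) :
  \sum_m weight_vector M mu m 0 * f m = \sum_(m in M) mu m * f m.
Proof.
rewrite [RHS]big_mkcond; apply: eq_bigr => m _.
by rewrite mxE; case: ifP; rewrite ?mul0r.
Qed.

Lemma walk_multipletP A u v p M mu :
  walk_multiplet A u v p M mu <->
  krylov_orthogonal A (parity_row u v p) (weight_vector M mu).
Proof.
split=> [mult | orth k _].
  apply: krylov_orthogonal_ltn => k ltkn; apply/matrixP=> i j.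
  by rewrite parity_row_mulE !weight_vector_sumE mult // subrr mxE.
have /matrixP/(_ 0 0)/eqP := orth k.
by rewrite parity_row_mulE !weight_vector_sumE mxE subr_eq0 => /eqP.
Qed.

Lemma trmxX_sym A k : A^T = A -> (A ^+ k)^T = A ^+ k.
Proof.
move=> symA; elim: k => [|k IHk]; first by rewrite expr0 trmx1.
by rewrite {1}exprS exprSr trmx_mul IHk symA.
Qed.

(** With B = A^k, the product expands to B_uu + p B_uv - p B_vu - p^2 B_vv, and symmetry of B
    cancels the mixed terms. *)
Lemma cospectralP A u v p : A^T = A -> p ^+ 2 = 1 ->
  cospectral A u v <->
  krylov_orthogonal A (parity_row u v p) (delta_mx u 0 + p *: delta_mx v 0).
Proof.
move=> symA p2.
have E k (i j : 'I_1) : (parity_row u v p *m A ^+ k *m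
    (delta_mx u 0 + p *: delta_mx v 0)) i j = (A ^+ k) u u - (A ^+ k) v v.
  have Auv : (A ^+ k) v u = (A ^+ k) u v by rewrite -{1}(trmxX_sym k symA) mxE.
  rewrite mulmxDr -scalemxAr -!colE /parity_row !mulmxBl -!scalemxAl -!rowE.
  rewrite !mxE Auv -[(A ^+ k) v v in RHS]mul1r -p2; ring.
split=> [cosp k | orth k].
  by apply/matrixP=> i j; rewrite E cosp subrr mxE.
by have /matrixP/(_ 0 0)/eqP := orth k; rewrite E mxE subr_eq0 => /eqP.
Qed.

(** The update adds c_i d_j + d_i c_j at (i, j). Zero extension kills the first product unless i is
    in X and j in Y, the second unless j is in X and i in Y; both survive only inside the
    intersection. *)
Lemma interconnection_rank2 A (X Y : {set 'I_n}) (gamma delta : 'I_n -> R) :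
  A^T = A ->
  let c := weight_vector X gamma in let d := weight_vector Y delta in
  interconnection A X Y gamma delta = A + c *m d^T + d *m c^T.
Proof.
move=> symA /=; apply/matrixP=> i j.
have Aji : A j i = A i j by rewrite -{1}symA mxE.
rewrite !mxE !big_ord1 !mxE /interconnection_weight !inE Aji.
case: (i \in X); case: (j \in Y); case: (j \in X); case: (i \in Y) => /=;
  rewrite ?(mulr0, mul0r, addr0) //; ring.
Qed.

End Multiplets.

Theorem theorem2 (R : realType) (N : nat) (G : 'M[R]_N) (symG : G^T = G)
    (u v : 'I_N) (cospG : cospectral G u v)
    (p : R) (parity : p = 1 \/ p = -1)
    (X Y : {set 'I_N}) (gamma delta : 'I_N -> R)
    (multX : walk_multiplet G u v p X gamma)
    (multY : walk_multiplet G u v p Y delta) :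
  let H := interconnection G X Y gamma delta in
  cospectral H u v /\
  (forall (M : {set 'I_N}) (mu : 'I_N -> R),
     walk_multiplet G u v p M mu -> walk_multiplet H u v p M mu).
Proof.
have p2 : p ^+ 2 = 1 by case: parity => ->; rewrite ?sqrrN expr1n.
move=> H; have HE : H = _ := interconnection_rank2 X Y gamma delta symG.
(* Transposition swaps the two rank-one terms. Symmetry makes [cospectralP] applicable to [H]. *)
have symH : H^T = H.
  by rewrite HE !linearD /= !trmx_mul !trmxK symG addrAC.
move/walk_multipletP in multX; move/walk_multipletP in multY.
split=> [|M mu /walk_multipletP multM].
  apply/(cospectralP u v symH p2); rewrite HE.
  apply: krylov_orthogonal_rank2_update => //.
  exact/(cospectralP u v symG p2).
by apply/walk_multipletP; rewrite HE; apply: krylov_orthogonal_rank2_update.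
Qed.
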